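(* Consider the seed with variables $a_1,\dots,a_5,b_1,\dots,b_5$ and the $\mathcal A_5$-quiver described in the context, and its Casimir functions $C_1=\prod_{i=1}^5a_i$ and $C_1C_2$, where $C_2=\prod_{i=1}^5 b_i$. Perform successively the mutations at $b_4,b_2,b_3$, then the mutations at $b_1$ and $b_5$, then interchange the labels $b_1\leftrightarrow b_5$, and then perform the mutations at $b_3,b_2,b_4$. The resulting seed again has the $\mathcal A_5$-quiver, with the two Casimir functions interchanged: in terms of the variables $\bar a_i,\bar b_i$ of the resulting seed, $\prod_i a_i=\prod_i\bar a_i\prod_i\bar b_i$ and $\prod_i a_i\prod_i b_i=\prod_i\bar a_i$. In particular, this chain of mutations transforms the condition $C_1C_2=-1$ into the condition $\prod_i\bar a_i=-1$.
   Context: The $\mathcal A_5$-quiver has vertices $a_i,b_i$ ($i\in\mathbb Z/5$) and arrows $b_i\to b_{i+1}$, $a_i\to a_{i+1}$, $a_i\to a_{i+2}$, $b_i\to a_i$, $a_{i+1}\to b_i$ for all $i$ modulo $5$. Write $B_{ij}$ for the number of arrows from vertex $i$ to vertex $j$ minus the number from $j$ to $i$. The Poisson bracket of the seed is $\{x_i,x_j\}=B_{ij}x_ix_j$; a Casimir function is one that Poisson commutes with all functions. Mutation at vertex $k$: the quiver changes by (1) adding an arrow $i\to j$ for each path $i\to k\to j$, (2) reversing all arrows at $k$, (3) cancelling oriented 2-cycles; the variables change by $x_k'=x_k^{-1}$ and $x_i'=x_i\bigl(1+x_k^{-\operatorname{sgn}(B_{ik})}\bigr)^{-B_{ik}}$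 for $i\ne k$. All identities are identities of rational functions. *)

(* Defs.v *)
From HB Require Import structures.
From mathcomp Require Import all_boot all_order all_algebra perm.
From mathcomp Require Import generic_quotient.
From mathcomp Require Import ring mpoly.

Set Implicit Arguments.
Unset Strict Implicit.
Unset Printing Implicit Defensive.

Import GRing.Theory.
Local Open Scope ring_scope.

(* The indices 1, ..., 5 live in Z/5, so a_ 5 = a_ 0 and b_ 5 = b_ 0. *)
Definition vertex : finType := ('Z_5 + 'Z_5)%type.
Definition a_ (i : 'Z_5) : vertex := inl i.
Definition b_ (i : 'Z_5) : vertex := inr i.

(* A quiver on these vertices: q v w is the number of arrows v -> w. *)
Definition quiver : Type := vertex -> vertex -> nat.

Definition A5_quiver : quiver := fun v w =>
  match v, w with
  | inl i, inl j => nat_of_bool (j == (i + 1)%R) + nat_of_bool (j == (i + 2)%R)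
  | inr i, inr j => nat_of_bool (j == (i + 1)%R)
  | inr i, inl j => nat_of_bool (j == i)
  | inl i, inr j => nat_of_bool (i == (j + 1)%R)
  end%N.

Definition exch (q : quiver) (v w : vertex) : int := (q v w)%:Z - (q w v)%:Z.

Definition add_paths (k : vertex) (q : quiver) : quiver :=
  fun v w => (q v w + q v k * q k w)%N.

Definition reverse_at (k : vertex) (q : quiver) : quiver :=
  fun v w => if (v == k) || (w == k) then q w v else q v w.

Definition cancel_2cycles (q : quiver) : quiver :=
  fun v w => (q v w - minn (q v w) (q w v))%N.

Definition quiver_mut (k : vertex) (q : quiver) : quiver :=
  cancel_2cycles (reverse_at k (add_paths k q)).

(* The variables of a seed take values in a field K: a field of rational
   functions for the seeds themselves, or a field of constants when the same
   formulas are applied to the coordinates of a point. *)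
Record seed (K : Type) := Seed { arrows : quiver; var : vertex -> K }.

Section Mutation.
Variable K : fieldType.
Implicit Types S : seed K.

Definition mut (k : vertex) S : seed K :=
  let x := var S in let B := exch (arrows S) in
  Seed (quiver_mut k (arrows S))
       (fun v => if v == k then (x k)^-1
                 else x v * (1 + x k ^ (- sgz (B v k))) ^ (- B v k)).

Definition swap_labels (u v : vertex) S : seed K :=
  Seed (fun w z => arrows S (tperm u v w) (tperm u v z))
       (fun w => var S (tperm u v w)).

End Mutation.

Variant step := Mut of vertex | Swap of vertex & vertex.

Definition do_step (K : fieldType) (s : step) (S : seed K) : seed K :=
  match s with
  | Mut k => mut k S
  | Swap u v => swap_labels u v S
  end.

Fixpoint run (K : fieldType) (c : seq step) (S : seed K) : seed K :=
  if c is s :: c' then run c' (do_step s S) else S.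

(* For a seed whose variables are numbers, all nonzero: no factor 1 + x_k or
   1 + x_k^-1 vanishes along the chain.  All variables then stay nonzero, so
   the totalised inverse 0^-1 = 0 is never used. *)
Fixpoint defined_along (K : fieldType) (c : seq step) (S : seed K) : Prop :=
  if c is s :: c' then
    (if s is Mut k then var S k != -1 else true) /\
    defined_along c' (do_step s S)
  else True.

Definition A5_chain : seq step :=
  [:: Mut (b_ 4); Mut (b_ 2); Mut (b_ 3); Mut (b_ 1); Mut (b_ 5);
      Swap (b_ 1) (b_ 5); Mut (b_ 3); Mut (b_ 2); Mut (b_ 4)].

Section RationalFunctions.
Variable F : fieldType.

Definition ratfun : fieldType := {fraction {mpoly F[#|vertex|]}}.

Definition coordinate (v : vertex) : ratfun :=
  tofrac ('X_(enum_rank v) : {mpoly F[#|vertex|]}).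

(* The quotient rule, on a representative of the fraction; partial_frac shows
   that the choice of representative is irrelevant. *)
Definition partial (v : vertex) (f : ratfun) : ratfun :=
  let n := \n_(repr f) in let d := \d_(repr f) in
  tofrac (mderiv (enum_rank v) n * d - n * mderiv (enum_rank v) d)
    / tofrac (d ^+ 2).

(* The bracket with {x_v, x_w} = B_vw x_v x_w (see poisson_coordinate), where
   the x_v are the coordinates. *)
Definition poisson (q : quiver) (f g : ratfun) : ratfun :=
  \sum_(v : vertex) \sum_(w : vertex)
    (exch q v w)%:~R * coordinate v * coordinate w * partial v f * partial w g.

Definition casimir (q : quiver) (f : ratfun) : Prop :=
  forall g : ratfun, poisson q f g = 0.

Lemma tofrac_repr (f : ratfun) :
  f = tofrac \n_(repr f) / tofrac \d_(repr f).
Proof.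
have d0 : tofrac \d_(repr f) != 0 :> ratfun by rewrite tofrac_eq0 denom_ratioP.
apply: (mulIf d0); rewrite mulfVK //; set r := repr f.
have -> : f = (\pi_ratfun r)%qT by rewrite /r reprK.
rewrite !piE; apply/eqmodP; rewrite /= FracField.equivfE.
by rewrite !numden_Ratio ?mulf_neq0 ?denom_ratioP ?oner_eq0 // !mulr1 mulrC.
Qed.

Lemma partial_frac v (n d : {mpoly F[#|vertex|]}) : d != 0 ->
  partial v (tofrac n / tofrac d) =
  tofrac (mderiv (enum_rank v) n * d - n * mderiv (enum_rank v) d)
    / tofrac (d ^+ 2).
Proof.
move=> d0; rewrite /partial.
have := tofrac_repr (tofrac n / tofrac d).
have := denom_ratioP (repr (tofrac n / tofrac d : ratfun)).
move: (\n_(repr _)) (\d_(repr _)) => N D D0.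
have tf0 (p : {mpoly F[#|vertex|]}) : p != 0 -> tofrac p != 0 :> ratfun.
  by rewrite tofrac_eq0.
move/eqP; rewrite eqr_div ?tf0 // -!tofracM tofrac_eq => /eqP e.
apply/eqP; rewrite eqr_div ?tf0 ?expf_neq0 // -!tofracM tofrac_eq.
have := congr1 (mderiv (enum_rank v)) e; rewrite !mderivM => e'.
set n' := mderiv _ n in e' *; set d' := mderiv _ d in e' *.
set N' := mderiv _ N in e' *; set D' := mderiv _ D in e' *.
have -> : (n' * d - n * d') * D ^+ 2
    = d * D * (n' * D + n * D') - n * D * (d' * D + d * D') by ring.
by rewrite e' e; apply/eqP; ring.
Qed.

Lemma partial_coordinate v w : partial v (coordinate w) = (v == w)%:R.
Proof.
rewrite -[coordinate w]divr1 -tofrac1 partial_frac ?oner_neq0 //.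
rewrite expr1n tofrac1 divr1 mulr1 -mpolyC1 mderivC mulr0 subr0 mderivX.
rewrite mnm1E (inj_eq enum_rank_inj) eq_sym; case: eqVneq => [->|_].
  by rewrite scale1r -{1}[U_(_)%MM]add0m addmK mpolyX0 tofrac1.
by rewrite scale0r tofrac0.
Qed.

Lemma poisson_coordinate q v w :
  poisson q (coordinate v) (coordinate w)
  = (exch q v w)%:~R * coordinate v * coordinate w.
Proof.
rewrite /poisson (bigD1 v) //= (bigD1 w) //= !partial_coordinate !eqxx !mulr1.
rewrite !big1 ?addr0 // => [u uv|u uw]; last first.
  by rewrite partial_coordinate (negPf uw) mulr0.
by rewrite big1 // => z _; rewrite partial_coordinate (negPf uv) mulr0 mul0r.
Qed.

End RationalFunctions.

(* Main.v *)
Require Import Defs.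
From mathcomp Require Import all_boot all_order all_algebra.
From mathcomp Require Import mpoly.
From mathcomp Require Import perm ring.

Set Implicit Arguments.
Unset Strict Implicit.
Unset Printing Implicit Defensive.

Import GRing.Theory.
Local Open Scope ring_scope.

(** Attach an integer weight w_v to every vertex and consider the monomial
M = prod_v x_v ^ w_v.  When the column of B at k is orthogonal to w, the sum
s = sum_v w_v [B_vk]_+ equals sum_v w_v [- B_vk]_+, so mutation at k, which
multiplies x_v by (1 + x_k) ^ [- B_vk]_+ / (1 + x_k^-1) ^ [B_vk]_+, multiplies
the product over v <> k by ((1 + x_k) / (1 + x_k^-1)) ^ s = x_k ^ s.  Hence M
is again a monomial in the mutated variables: the weights away from k are
unchanged and w_k becomes s - w_k ([monomial_mut]).  Exchanging labels
permutes the weights.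

A monomial whose weights are annihilated by all of B is a Casimir function
([casimir_monomial]), because its logarithmic derivatives are the w_v.  For
the quiver at hand the weights of C_1 (1 on the a_i, 0 on the b_i) and of
C_1 C_2 (1 everywhere) are such.  Following quivers and weights along the
chain is a finite integer computation ([A5_chain_C1], [A5_chain_C1C2]); it
returns the initial quiver and interchanges the two weights.

All this holds over any field in which the chain is defined, which gives both
the identities between rational functions and the statement on points.  For
the coordinates themselves the chain is defined because every variable it
produces is subtraction-free: it is a quotient of polynomials that take
positive integer values at (1, ..., 1), and these do not vanish in
characteristic 0 ([coordinate_defined_along]). *)

(** * Monomials under one mutation *)

(** The positive part of B_vk; [targets] is the negative part.  As truncated
differences they are unaffected by 2-cycles and loops. *)
Definition sources (q : quiver) (k v : vertex) : nat := (q v k - q k v)%N.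
Definition targets (q : quiver) (k v : vertex) : nat := (q k v - q v k)%N.

Definition monomial (K : fieldType) (x : vertex -> K) (w : vertex -> int) : K :=
  \prod_v x v ^ w v.

(** The weights after mutation.  This is the tropical analogue of an exchange
relation. *)
Definition mut_weight (k : vertex) (q : quiver) (w : vertex -> int) :
    vertex -> int :=
  fun v => if v == k then \sum_u w u * (sources q k u)%:Z - w k else w v.

(** Orthogonality of [w] to column [k] of B, with the two signs separated. *)
Definition balanced (k : vertex) (q : quiver) (w : vertex -> int) : Prop :=
  \sum_u w u * (sources q k u)%:Z = \sum_u w u * (targets q k u)%:Z.

Lemma prodr_exprz (K : fieldType) (t : K) (f : vertex -> int) :
  t != 0 -> \prod_v t ^ f v = t ^ (\sum_v f v).
Proof.
move=> t0; symmetry; apply: (big_morph (fun n => t ^ n)) => // m n.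
exact: expfzDr.
Qed.

Section MutationOfMonomials.
Variables (K : fieldType) (S : seed K) (k : vertex).
Hypotheses (x0 : forall v, var S v != 0) (xk1 : var S k != -1).
Let x := var S.
Let q := arrows S.

Lemma addr1_neq0 : 1 + x k != 0.
Proof. by rewrite addrC addr_eq0. Qed.

Lemma addr1VE : 1 + (x k)^-1 = (1 + x k) / x k.
Proof. by rewrite mulrDl mul1r mulfV ?x0 // addrC. Qed.

Lemma addr1V_neq0 : 1 + (x k)^-1 != 0.
Proof. by rewrite addr1VE mulf_neq0 ?invr_eq0 ?addr1_neq0 ?x0. Qed.

(** The three signs of B_vk in the mutation rule collapse into one formula,
since at most one of the two exponents is nonzero. *)
Lemma var_mut v : v != k ->
  var (mut k S) v = x v * ((1 + x k) ^ (targets q k v)%:Z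
                           / (1 + (x k)^-1) ^ (sources q k v)%:Z).
Proof.
move=> /negPf vk; rewrite /= vk -/x -/q /exch /sources /targets.
congr (_ * _); case: (ltngtP (q v k) (q k v)) => [lt|lt|->].
- have /eqP -> : (q v k - q k v == 0)%N by rewrite subn_eq0 ltnW.
  rewrite -opprB subzn 1?ltnW // sgzN opprK opprK expr0z divr1.
  by rewrite gtr0_sgz ?expr1z // ltz_nat subn_gt0.
- have /eqP -> : (q k v - q v k == 0)%N by rewrite subn_eq0 ltnW.
  rewrite subzn 1?ltnW // expr0z mul1r gtr0_sgz ?ltz_nat ?subn_gt0 //.
  by rewrite exprN1 invr_expz.
- by rewrite subrr oppr0 subnn !expr0z divr1.
Qed.

Lemma var_mut_neq0 v : var (mut k S) v != 0.
Proof.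
case: (eqVneq v k) => [->|vk]; first by rewrite /= eqxx invr_eq0.
rewrite var_mut // mulf_neq0 ?x0 // mulf_neq0 ?invr_eq0 //.
  by rewrite expfz_neq0 ?addr1_neq0.
by rewrite expfz_neq0 ?addr1V_neq0.
Qed.

(** The factors acquired by the variables other than x_k multiply to
((1 + x_k) / (1 + x_k^-1)) ^ s = x_k ^ s, which is absorbed in the exponent
of x_k. *)
Lemma monomial_mut w : balanced k q w ->
  monomial (var (mut k S)) (mut_weight k q w) = monomial x w.
Proof.
move=> bal; set s := \sum_u w u * (sources q k u)%:Z.
pose y v := (1 + x k) ^ (w v * (targets q k v)%:Z)
            * (1 + (x k)^-1) ^ (- (w v * (sources q k v)%:Z)).
have prod_y : \prod_(v | v != k) y v = x k ^ s.
  (* There is no factor at k itself, as B_kk = 0. *)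
  transitivity (\prod_v y v).
    rewrite [RHS](bigD1 k) //= /y /sources /targets subnn.
    by rewrite mulr0 oppr0 !expr0z !mul1r.
  rewrite big_split /= !prodr_exprz ?addr1_neq0 ?addr1V_neq0 //.
  rewrite sumrN -bal -/s addr1VE expfzMl exprz_inv opprK mulrA.
  by rewrite -expfzDr ?addr1_neq0 // subrr expr0z mul1r.
rewrite /monomial (bigD1 k) //= [RHS](bigD1 k) //= /mut_weight !eqxx -/s.
rewrite (eq_bigr (fun v => x v ^ w v * y v)) => [|v vk]; last first.
  rewrite -[X in X ^ _]/(var (mut k S) v) var_mut // (negPf vk) /y !expfzMl.
  by rewrite invr_expz !exprz_exp mulNr !(mulrC (w v)).
rewrite big_split /= prod_y -/x exprz_inv opprB mulrCA -expfzDr ?x0 //.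
by rewrite subrK mulrC.
Qed.
End MutationOfMonomials.

(** * Checking a chain of seeds by computation *)

Definition vertices : seq vertex :=
  [seq a_ i | i <- [:: 0; 1; 2; 3; 4]] ++ [seq b_ i | i <- [:: 0; 1; 2; 3; 4]].

Definition vertex_index (v : vertex) : nat :=
  match v with inl i => i | inr i => (5 + i)%N end.

Lemma mem_vertices v : v \in vertices.
Proof. by case: v => [] [] [|[|[|[|[|]]]]]. Qed.

Lemma index_vertices v : index v vertices = vertex_index v.
Proof. by case: v => [] [] [|[|[|[|[|]]]]]. Qed.

Lemma big_vertices (R : Type) (idx : R) (op : Monoid.com_law idx) f :
  \big[op/idx]_v f v = \big[op/idx]_(v <- vertices) f v.
Proof.
apply: perm_big; apply: uniq_perm => [||v]; rewrite ?index_enum_uniq //.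
by rewrite mem_vertices mem_index_enum.
Qed.

(** Evaluates [f] once at each vertex: without this, a quiver obtained by
successive mutations would recompute its predecessors exponentially often. *)
Definition tabulate (T : Type) (d : T) (f : vertex -> T) : vertex -> T :=
  let t := [seq f v | v <- vertices] in fun v => nth d t (vertex_index v).

Lemma tabulateE T (d : T) f : tabulate d f =1 f.
Proof.
move=> v; rewrite /tabulate -index_vertices (nth_map v) ?nth_index //;
  by rewrite ?index_mem mem_vertices.
Qed.

Definition tabulate_quiver (q : quiver) : quiver :=
  tabulate (fun=> 0%N) (fun v => tabulate 0%N (q v)).

Lemma tabulate_quiverE q : tabulate_quiver q =2 q.
Proof. by move=> v w; rewrite /tabulate_quiver !tabulateE. Qed.

Definition all_vertices (P : pred vertex) : bool := all P vertices.

Lemma all_verticesP (P : pred vertex) :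
  reflect (forall v, P v) (all_vertices P).
Proof.
by apply: (iffP allP) => [h v|h v _]; [apply: h; apply: mem_vertices|apply: h].
Qed.

(** A form of the sum over all vertices that reduces. *)
Definition sum_vertices (f : vertex -> int) : int :=
  foldr +%R 0 [seq f v | v <- vertices].

Lemma sum_verticesE f : sum_vertices f = \sum_v f v.
Proof. by rewrite /sum_vertices foldrE big_map big_vertices. Qed.

(** A form of [tperm] that reduces. *)
Definition transposition (u v w : vertex) : vertex :=
  if w == u then v else if w == v then u else w.

Lemma tperm_transposition u v w : tperm u v w = transposition u v w.
Proof. by rewrite permE. Qed.

Definition step_ok (s : step) (q : quiver) (w : vertex -> int) : bool :=
  if s is Mut k then
    sum_vertices (fun u => w u * (sources q k u)%:Z)
      == sum_vertices (fun u => w u * (targets q k u)%:Z)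
  else true.

Definition step_quiver (s : step) (q : quiver) : quiver :=
  match s with
  | Mut k => quiver_mut k q
  | Swap u v => fun y z => q (transposition u v y) (transposition u v z)
  end.

Definition step_weight (s : step) (q : quiver) (w : vertex -> int) :
    vertex -> int :=
  match s with
  | Mut k => fun v => if v == k
      then sum_vertices (fun u => w u * (sources q k u)%:Z) - w k else w v
  | Swap u v => fun y => w (transposition u v y)
  end.

(** A certificate, independent of the field and of the values of the variables,
that the chain leads from the quiver [q] to [q'] and rewrites the monomial of
weights [w] as the monomial of weights [w'] in the final variables. *)
Fixpoint transports (c : seq step) (q : quiver) (w : vertex -> int)
    (q' : quiver) (w' : vertex -> int) : bool :=
  if c is s :: c' then
    step_ok s q w && transports c' (tabulate_quiver (step_quiver s q))
                                (tabulate 0 (step_weight s q w)) q' w'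
  else all_vertices (fun v => (w v == w' v)
                              && all_vertices (fun z => q v z == q' v z)).

Lemma eq_quiver_mut k q q' : q =2 q' -> quiver_mut k q =2 quiver_mut k q'.
Proof.
move=> e v w.
by rewrite /quiver_mut /cancel_2cycles /reverse_at /add_paths !e.
Qed.

Lemma eq_monomial (K : fieldType) (x : vertex -> K) w w' :
  w =1 w' -> monomial x w = monomial x w'.
Proof. by move=> e; apply: eq_bigr => v _; rewrite e. Qed.

Section Step.
Variables (K : fieldType) (S : seed K) (s : step) (q : quiver).
Hypothesis Sq : arrows S =2 q.

Lemma arrows_step : arrows (do_step s S) =2 step_quiver s q.
Proof.
case: s => [k|u v] y z; first exact: eq_quiver_mut.
by rewrite /= !tperm_transposition.
Qed.

Hypothesis x0 : forall v, var S v != 0.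
Hypothesis x1 : if s is Mut k then is_true (var S k != -1) else is_true true.

Lemma var_step_neq0 v : var (do_step s S) v != 0.
Proof. by case: s x1 => [k xk1|u z _]; [apply: var_mut_neq0|apply: x0]. Qed.

Lemma monomial_step w : step_ok s q w ->
  monomial (var (do_step s S)) (step_weight s q w) = monomial (var S) w.
Proof.
case: s x1 => [k xk1|u v _] /=; last first.
  move=> _; rewrite [RHS](reindex_inj (@perm_inj _ (tperm u v))).
  by apply: eq_bigr => y _; rewrite /= tperm_transposition.
have eqs : sources (arrows S) k =1 sources q k.
  by move=> v; rewrite /sources !Sq.
have eqt : targets (arrows S) k =1 targets q k.
  by move=> v; rewrite /targets !Sq.
have sumE (f g : vertex -> nat) : f =1 g ->
    sum_vertices (fun u => w u * (g u)%:Z) = \sum_u w u * (f u)%:Z.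
  by move=> e; rewrite sum_verticesE; apply: eq_bigr => u _; rewrite e.
rewrite (sumE _ _ eqs) (sumE _ _ eqt) => /eqP bal.
exact: monomial_mut.
Qed.
End Step.

Lemma arrows_run (K : fieldType) (c : seq step) (S : seed K) q w q' w' :
  arrows S =2 q -> transports c q w q' w' -> arrows (run c S) =2 q'.
Proof.
elim: c S q w => [|s c IH] S q w Sq /=.
  move=> /all_verticesP h v z; rewrite Sq.
  by case/andP: (h v) => _ /all_verticesP/(_ z)/eqP.
case/andP=> _; apply: IH => v z.
by rewrite tabulate_quiverE; apply: arrows_step.
Qed.

Lemma monomial_run (K : fieldType) (c : seq step) (S : seed K) q w q' w' :
  arrows S =2 q -> (forall v, var S v != 0) -> defined_along c S ->
  transports c q w q' w' ->
  monomial (var (run c S)) w' = monomial (var S) w.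
Proof.
elim: c S q w => [|s c IH] S q w Sq x0 /=.
  move=> _ /all_verticesP h; apply: eq_monomial => v.
  by case/andP: (h v) => /eqP.
case=> x1 def /andP[ok ok'].
have Sq' : arrows (do_step s S) =2 tabulate_quiver (step_quiver s q).
  by move=> v z; rewrite tabulate_quiverE; apply: arrows_step.
rewrite (IH _ _ _ Sq' (var_step_neq0 (s := s) x0 x1) def ok').
by rewrite (eq_monomial _ (tabulateE _ _)); apply: monomial_step.
Qed.

(** * The chain for the A5-quiver *)

Definition ab_weight (m n : int) (v : vertex) : int :=
  match v with inl _ => m | inr _ => n end.

Lemma monomial_ab (K : fieldType) (x : vertex -> K) m n :
  monomial x (ab_weight m n)
  = (\prod_i x (a_ i)) ^ m * (\prod_i x (b_ i)) ^ n.
Proof.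
rewrite /monomial big_sumType /=.
by rewrite !(big_morph (fun t => t ^ _) (fun x y => expfzMl x y _)
                     (exp1rz _ _)).
Qed.

Lemma A5_chain_C1 :
  transports A5_chain A5_quiver (ab_weight 1 0) A5_quiver (ab_weight 1 1).
Proof. by vm_compute. Qed.

Lemma A5_chain_C1C2 :
  transports A5_chain A5_quiver (ab_weight 1 1) A5_quiver (ab_weight 1 0).
Proof. by vm_compute. Qed.

Lemma A5_chain_interchange (K : fieldType) (x : vertex -> K) :
  let S := Seed A5_quiver x in let S' := run A5_chain S in
  (forall v, x v != 0) -> defined_along A5_chain S ->
  let C1' := \prod_i var S' (a_ i) in
  let C2' := \prod_i var S' (b_ i) in
  \prod_i x (a_ i) = C1' * C2' /\
  (\prod_i x (a_ i)) * (\prod_i x (b_ i)) = C1'.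
Proof.
move=> S S' x0 def C1' C2'.
have := monomial_run (S := S) (fun _ _ => erefl) x0 def A5_chain_C1C2.
have := monomial_run (S := S) (fun _ _ => erefl) x0 def A5_chain_C1.
(* Abstracting the final variables keeps rewriting from unfolding the chain. *)
rewrite -/S' /C1' /C2'; move: (var S') => y.
by rewrite !monomial_ab !expr1z !expr0z !mulr1.
Qed.

(** * Subtraction-free values *)

(** Mutation involves only 1, +, * and inverses.  A set closed under these that
contains the initial variables therefore contains all variables along a chain;
if it omits 0, then it also omits -1, as 1 + (-1) = 0. *)
Section SubtractionFree.
Variables (K : fieldType) (P : K -> Prop).
Hypotheses (P1 : P 1) (P0 : ~ P 0).
Hypothesis PD : forall x y, P x -> P y -> P (x + y).
Hypothesis PM : forall x y, P x -> P y -> P (x * y).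
Hypothesis PV : forall x, P x -> P x^-1.

Lemma exprz_closed x (n : int) : P x -> P (x ^ n).
Proof.
move=> Px; have Pn (m : nat) : P (x ^+ m).
  by elim: m => [|m IH]; rewrite ?expr0 // exprS; apply: PM.
by case: n => n; [apply: Pn|apply: PV; apply: Pn].
Qed.

Lemma defined_along_closed c (S : seed K) :
  (forall v, P (var S v)) -> defined_along c S.
Proof.
elim: c S => [|s c IH] S PS //=; split.
  case: s => // k; apply/eqP=> xk; apply: P0.
  by rewrite -(subrr 1) -xk; apply: PD.
apply: IH => v; case: s => [k|u z] /=; last exact: PS.
case: eqP => _; first exact: PV.
by apply: PM => //; apply/exprz_closed/PD => //; apply: exprz_closed.
Qed.
End SubtractionFree.

(** * The coordinates are subtraction-free *)

Section RationalFunctions.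
Variable F : fieldType.
Implicit Types (p n d : {mpoly F[#|vertex|]}) (f g : ratfun F).

(** Positivity of the value at (1, ..., 1), with positive integers read in F.
This is preserved by + and *, and in characteristic 0 it excludes 0. *)
Definition positive_poly p : Prop := exists m, p.@[fun=> 1] = m.+1%:R.

Definition positive f : Prop :=
  exists n d, [/\ positive_poly n, positive_poly d & f = tofrac n / tofrac d].

Lemma positive_polyD p n :
  positive_poly p -> positive_poly n -> positive_poly (p + n).
Proof.
move=> [i pi] [j nj]; exists (i + j.+1)%N.
by rewrite mevalD pi nj -natrD addSn.
Qed.

Lemma positive_polyM p n :
  positive_poly p -> positive_poly n -> positive_poly (p * n).
Proof.
move=> [i pi] [j nj]; exists (j + i * j.+1)%N.
by rewrite mevalM pi nj -natrM mulSn addSn.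
Qed.

Lemma positive_poly1 : positive_poly 1.
Proof. by exists 0%N; rewrite meval1. Qed.

Lemma positive_coordinate v : positive (coordinate F v).
Proof.
exists 'X_(enum_rank v), 1; split; last by rewrite tofrac1 divr1.
  by exists 0%N; rewrite mevalXU.
exact: positive_poly1.
Qed.

Hypothesis charF0 : [pchar F] =i pred0.

Lemma positive_poly_neq0 p : positive_poly p -> p != 0.
Proof.
case=> m pm; apply/eqP=> p0; move/eqP: pm.
by rewrite p0 meval0 eq_sym (proj1 (pcharf0P F) charF0).
Qed.

Lemma tofrac_positive_neq0 p : positive_poly p -> tofrac p != 0 :> ratfun F.
Proof. by move=> /positive_poly_neq0; rewrite tofrac_eq0. Qed.

Lemma positive_neq0 f : positive f -> f != 0.
Proof.
move=> [n [d [n0 d0 ->]]].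
by rewrite mulf_neq0 ?invr_eq0 ?tofrac_positive_neq0.
Qed.

Lemma positive1 : positive 1.
Proof.
exists 1, 1; split; try exact: positive_poly1.
by rewrite tofrac1 divr1.
Qed.

Lemma positiveD f g : positive f -> positive g -> positive (f + g).
Proof.
move=> [n [d [n0 d0 ->]]] [n' [d' [n0' d0' ->]]].
exists (n * d' + n' * d), (d * d'); split; try exact: positive_polyM.
  by apply: positive_polyD; apply: positive_polyM.
by rewrite addf_div ?tofrac_positive_neq0 // tofracD !tofracM.
Qed.

Lemma positiveM f g : positive f -> positive g -> positive (f * g).
Proof.
move=> [n [d [n0 d0 ->]]] [n' [d' [n0' d0' ->]]].
exists (n * n'), (d * d'); split; try exact: positive_polyM.
by rewrite mulf_div !tofracM.
Qed.

Lemma positiveV f : positive f -> positive f^-1.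
Proof. by move=> [n [d [n0 d0 ->]]]; exists d, n; split; rewrite ?invf_div. Qed.

Lemma coordinate_neq0 v : coordinate F v != 0.
Proof. exact/positive_neq0/positive_coordinate. Qed.

Lemma coordinate_defined_along q c :
  defined_along c (Seed q (@coordinate F)).
Proof.
apply: (@defined_along_closed _ positive).
- exact: positive1.
- by move=> /positive_neq0; rewrite eqxx.
- exact: positiveD.
- exact: positiveM.
- exact: positiveV.
- exact: positive_coordinate.
Qed.
End RationalFunctions.

(** * Monomial Casimir functions *)

Section Casimir.
Variable F : fieldType.

Lemma monomial_coordinate (w : vertex -> nat) :
  monomial (@coordinate F) (fun v => (w v)%:Z)
  = tofrac 'X_[[multinom w (enum_val i) | i < #|vertex|]].
Proof.
rewrite mpolyXE_id rmorph_prod /=.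
rewrite (reindex_onto enum_rank enum_val) /=; last first.
  by move=> i _; apply: enum_valK.
rewrite /monomial; apply: eq_big => [v|v _]; first by rewrite enum_rankK eqxx.
by rewrite mnmE enum_rankK tofracXn.
Qed.

(** Euler's relation in the single variable x_v. *)
Lemma partial_monomial (w : vertex -> nat) v :
  let M := monomial (@coordinate F) (fun v => (w v)%:Z) in
  coordinate F v * partial v M = M *+ w v.
Proof.
rewrite /= monomial_coordinate; set m := [multinom _ | _ < _].
rewrite -[in LHS](divr1 (tofrac 'X_[m])) -tofrac1 partial_frac ?oner_neq0 //.
rewrite expr1n tofrac1 divr1 mulr1 -mpolyC1 mderivC mulr0 subr0 mderivX.
have -> : m (enum_rank v) = w v by rewrite mnmE enum_rankK.
rewrite -tofracM -scalerAr -mpolyXD scaler_nat.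
(* For w v = 0 the monomial m - U_v would be truncated, but its coefficient
   is 0. *)
case: (posnP (w v)) => [->|w0]; first by rewrite !mulr0n tofrac0.
rewrite rmorphMn /= addmC submK // lep1mP mnmE enum_rankK -lt0n //.
Qed.

(** By Euler's relation {M, g} is M times
sum_z (sum_v w_v B_vz) x_z dg/dx_z. *)
Lemma casimir_monomial (q : quiver) (w : vertex -> nat) :
  (forall v, \sum_u (w u)%:Z * exch q u v = 0) ->
  casimir q (monomial (@coordinate F) (fun v => (w v)%:Z)).
Proof.
move=> ker g; set M := monomial _ _; rewrite /poisson exchange_big /=.
rewrite big1 // => z _.
transitivity ((\sum_v (w v)%:Z * exch q v z)%:~R * M * coordinate F z
              * partial z g); last by rewrite ker !mul0r.
rewrite rmorph_sum /= !mulr_suml; apply: eq_bigr => v _.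
have := partial_monomial w v; rewrite -/M => e.
transitivity ((exch q v z)%:~R * (coordinate F v * partial v M)
              * coordinate F z * partial z g); first by ring.
by rewrite e rmorphM /= -mulr_natr; ring.
Qed.

Definition annihilates (q : quiver) (w : vertex -> nat) : bool :=
  all_vertices (fun v => sum_vertices (fun u => (w u)%:Z * exch q u v) == 0).

Lemma casimir_ab (m n : nat) :
  annihilates A5_quiver (fun v => if v is inl _ then m else n) ->
  casimir A5_quiver ((\prod_i coordinate F (a_ i)) ^+ m
                     * (\prod_i coordinate F (b_ i)) ^+ n).
Proof.
move=> /all_verticesP ann.
have -> : (\prod_i coordinate F (a_ i)) ^+ m
          * (\prod_i coordinate F (b_ i)) ^+ n
  = monomial (@coordinate F) (fun v => (if v is inl _ then m else n)%:Z).
  rewrite -[LHS]/(_ ^ m%:Z * _ ^ n%:Z) -monomial_ab.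
  by apply: eq_monomial; case.
apply: casimir_monomial => v; rewrite -sum_verticesE; exact/eqP/ann.
Qed.
End Casimir.

Theorem mainTheorem2 (F : fieldType) (charF0 : [pchar F] =i pred0) :
  (let S := Seed A5_quiver (@coordinate F) in
   let S' := run A5_chain S in
   let C1 := \prod_(i : 'Z_5) var S (a_ i) in
   let C2 := \prod_(i : 'Z_5) var S (b_ i) in
   let C1' := \prod_(i : 'Z_5) var S' (a_ i) in
   let C2' := \prod_(i : 'Z_5) var S' (b_ i) in
   [/\ casimir A5_quiver C1,
       casimir A5_quiver (C1 * C2),
       arrows S' =2 A5_quiver,
       C1 = C1' * C2'
     & C1 * C2 = C1'])
  /\
  (forall x : vertex -> F,
     (forall v : vertex, x v != 0) ->
     let S := Seed A5_quiver x in
     let S' := run A5_chain S in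
     defined_along A5_chain S ->
     (\prod_(i : 'Z_5) x (a_ i)) * (\prod_(i : 'Z_5) x (b_ i)) = -1 <->
     \prod_(i : 'Z_5) var S' (a_ i) = -1).
Proof.
split; last first.
  by move=> x x0 S S' def; have [_ ->] := A5_chain_interchange x0 def.
have [e1 e2] := A5_chain_interchange (coordinate_neq0 charF0)
  (coordinate_defined_along charF0 A5_quiver A5_chain).
split=> //.
- have := @casimir_ab F 1 0; rewrite expr1 expr0 mulr1; apply.
  by vm_compute.
- have := @casimir_ab F 1 1; rewrite !expr1; apply.
  by vm_compute.
- exact: arrows_run A5_chain_C1.
Qed.
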